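(* Let $G$ be a group (not necessarily finite) and let $H \unlhd G$ be a normal subgroup. There is a $G$-invariant transversal for $G/H$ if and only if both of the following conditions hold: (i) $G = H C_G(H)$, and (ii) $C_{G/H}(Hg) = H C_G(g)/H$ for all $g \in G$.
   Context: $C_G(x)$ and $C_G(L)$ denote the centralizer in $G$ of an element $x \in G$, respectively of a subgroup $L \leq G$; $C_{G/H}(Hg)$ is the centralizer of the element $Hg$ in the quotient group $G/H$. A transversal for $G/H$ is a subset $T \subseteq G$ containing exactly one element of each coset of $H$ in $G$. A subset of $G$ is $G$-invariant if it is invariant under conjugation by all elements of $G$, i.e. it is a union of conjugacy classes of $G$. *)

(* Defs.v *)
From HB Require Import structures.
From mathcomp Require Import all_boot.
From mathcomp Require Import boolp classical_sets.

Set Implicit Arguments.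
Unset Strict Implicit.
Unset Printing Implicit Defensive.

Local Open Scope quotient_scope.
Local Open Scope classical_set_scope.
Local Open Scope group_scope.

(* Subsets of a (possibly infinite) group [G : groupType] are classical sets.
   The choiceType structure carried by a groupType is no restriction: by
   [boolp.gen_eqMixin] and [boolp.gen_choiceMixin] every type has one. *)

Record normalSubgroup (G : groupType) := NormalSubgroup {
  normalSubgroup_set :> set G;
  normalSubgroup_closed : group_closed [in normalSubgroup_set];
  normalSubgroup_conj :
    forall h g : G, h \in normalSubgroup_set -> h ^ g \in normalSubgroup_set }.

Section Sets.
Variable G : groupType.
Implicit Types (A B L T : set G) (x g : G).

Definition setprod A B : set G := [set a * b | a in A & b in B].

Definition rightcoset A g : set G := [set a * g | a in A].

Definition centraliser1 x : set G := [set y | commute y x].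

Definition centraliser L : set G := [set y | forall x, L x -> commute y x].

Definition conj_invariant T : Prop := forall g, [set t ^ g | t in T] = T.

Definition coset_transversal (H : normalSubgroup G) T : Prop :=
  forall g, exists! t, (T `&` rightcoset H g) t.

End Sets.

Section Quotient.
Variables (G : groupType) (H : normalSubgroup G).
Implicit Types x y g h : G.
Local Notation inH := (normalSubgroup_set H).

Lemma normalSubgroup1 : inH 1.
Proof. by have [/set_mem] := normalSubgroup_closed H. Qed.

Lemma normalSubgroupM x y : inH x -> inH y -> inH (x * y).
Proof.
move=> /mem_set Hx /mem_set Hy; apply/set_mem.
exact: (group_closedM (normalSubgroup_closed H)).
Qed.

Lemma normalSubgroupV x : inH x -> inH x^-1.
Proof.
move=> /mem_set Hx; apply/set_mem.
exact: (group_closedV (normalSubgroup_closed H)).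
Qed.

Lemma normalSubgroupJ x g : inH x -> inH (x ^ g).
Proof. by move=> /mem_set Hx; apply/set_mem/normalSubgroup_conj. Qed.

Lemma rightcosetP x y : rightcoset H x = rightcoset H y <-> inH (x * y^-1).
Proof.
split=> [eq_xy|Hxy].
  have [h Hh <-] : rightcoset H y x.
    by rewrite -eq_xy; exists 1; [exact: normalSubgroup1 | rewrite mul1g].
  by rewrite mulgK.
apply/seteqP; split=> _ [h Hh <-].
  exists (h * (x * y^-1)); first exact: normalSubgroupM.
  by rewrite -!mulgA mulVg mulg1.
exists (h * (x * y^-1)^-1).
  by apply: normalSubgroupM => //; apply: normalSubgroupV.
by rewrite invgM invgK -!mulgA mulVg mulg1.
Qed.

(* G / H is the type of elements of G modulo equality of their cosets *)
Definition same_coset : rel G :=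
  fun x y => `[< rightcoset H x = rightcoset H y >].

Lemma same_cosetP x y : reflect (inH (x * y^-1)) (same_coset x y).
Proof. by apply: (iffP (asboolP _)) => /rightcosetP. Qed.

Lemma same_coset_refl : reflexive same_coset.
Proof. by move=> x; apply/asboolP. Qed.

Lemma same_coset_sym : symmetric same_coset.
Proof. by move=> x y; apply/asboolP/asboolP => ->. Qed.

Lemma same_coset_trans : transitive same_coset.
Proof. by move=> y x z /asboolP xy /asboolP yz; apply/asboolP; rewrite xy. Qed.

Canonical same_coset_equiv :=
  EquivRel same_coset same_coset_refl same_coset_sym same_coset_trans.

Definition quotientGroup := {eq_quot same_coset_equiv}.
HB.instance Definition _ := Choice.on quotientGroup.
HB.instance Definition _ := EqQuotient.on quotientGroup.

Definition coset g : quotientGroup := \pi_quotientGroup g.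

Lemma coset_eqP x y : coset x = coset y <-> rightcoset H x = rightcoset H y.
Proof.
split=> [/eqmodP/asboolP //|eq_xy].
by apply/eqmodP/asboolP.
Qed.

Lemma coset_eqH x y : coset x = coset y <-> inH (x * y^-1).
Proof. by rewrite coset_eqP rightcosetP. Qed.

Lemma coset_repr (u : quotientGroup) : coset (repr u) = u.
Proof. exact: reprK. Qed.

Definition quotient_mul (u v : quotientGroup) := coset (repr u * repr v).
Definition quotient_one := coset 1.
Definition quotient_inv (u : quotientGroup) := coset (repr u)^-1.

Lemma quotient_mulE x y : quotient_mul (coset x) (coset y) = coset (x * y).
Proof.
apply/coset_eqH; set x' := repr _; set y' := repr _.
have Hx : inH (x' * x^-1) by apply/coset_eqH; rewrite coset_repr.
have Hy : inH (y' * y^-1) by apply/coset_eqH; rewrite coset_repr.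
have -> : x' * y' * (x * y)^-1 = (x' * x^-1) * (y' * y^-1) ^ x^-1.
  by rewrite conjgE invgK invgM !mulgA mulgVK.
by apply: normalSubgroupM => //; apply: normalSubgroupJ.
Qed.

Lemma quotient_invE x : quotient_inv (coset x) = coset x^-1.
Proof.
apply/coset_eqH; set x' := repr _.
have Hx : inH (x' * x^-1) by apply/coset_eqH; rewrite coset_repr.
have -> : x'^-1 * x^-1^-1 = ((x' * x^-1)^-1) ^ x.
  by rewrite conjgE invgM !invgK !mulgA mulVg mul1g.
by apply: normalSubgroupJ; apply: normalSubgroupV.
Qed.

Lemma quotient_mulA : associative quotient_mul.
Proof.
move=> u v w; rewrite -(coset_repr u) -(coset_repr v) -(coset_repr w).
by rewrite !quotient_mulE mulgA.
Qed.

Lemma quotient_mul1 : left_id quotient_one quotient_mul.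
Proof. by move=> u; rewrite -(coset_repr u) quotient_mulE mul1g. Qed.

Lemma quotient_mulg1 : right_id quotient_one quotient_mul.
Proof. by move=> u; rewrite -(coset_repr u) quotient_mulE mulg1. Qed.

Lemma quotient_mulV : left_inverse quotient_one quotient_inv quotient_mul.
Proof.
by move=> u; rewrite -(coset_repr u) quotient_invE quotient_mulE mulVg.
Qed.

Lemma quotient_mulgV : right_inverse quotient_one quotient_inv quotient_mul.
Proof.
by move=> u; rewrite -(coset_repr u) quotient_invE quotient_mulE mulgV.
Qed.

HB.instance Definition _ := isGroup.Build quotientGroup
  quotient_mulA quotient_mul1 quotient_mulg1 quotient_mulV quotient_mulgV.

Lemma cosetM x y : coset (x * y) = coset x * coset y.
Proof. by rewrite -quotient_mulE. Qed.

End Quotient.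

(* Main.v *)
(* If T is an invariant transversal and x commutes with t in T modulo H, then
   x commutes with t, because t ^ x lies in T and in the coset H t.  With x in H
   this gives T <= C_G(H), hence (i); for general x it gives (ii) at t, and (i)
   transfers this from t to every g in H t.
   Conversely, by (i) every conjugacy class of G / H contains the coset of some
   t in C_G(H); choose one such t for each class and let T consist of all their
   conjugates.  If t ^ x lies in H t then by (ii) x is in H C_G(t), which fixes
   t, so T meets each coset only once. *)

Require Import Defs.
From mathcomp Require Import all_boot.
From mathcomp Require Import boolp classical_sets.

Local Open Scope classical_set_scope.
Local Open Scope group_scope.

Lemma conjg_commute (G : groupType) (x y : G) : commute x y <-> x ^ y = x.
Proof. by split=> [/commgP/conjg_fixP | /conjg_fixP/commgP]. Qed.

Lemma conj_invariantJ (G : groupType) (T : set G) t x :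
  conj_invariant T -> T t -> T (t ^ x).
Proof. by move=> invT Tt; rewrite -(invT x); exists t. Qed.

Section Cosets.
Variables (G : groupType) (H : normalSubgroup G).
Implicit Types g h t x y : G.
Local Notation inH := (normalSubgroup_set H).

Lemma coset_mulH h x : inH h -> coset H (h * x) = coset H x.
Proof. by move=> Hh; apply/coset_eqH; rewrite mulgK. Qed.

Lemma rightcosetE g t : rightcoset H g t <-> coset H t = coset H g.
Proof.
rewrite coset_eqH; split=> [[h Hh <-]|Htg]; first by rewrite mulgK.
by exists (t * g^-1) => //; rewrite mulgVK.
Qed.

Lemma cosetJ x y : coset H (x ^ y) = coset H x ^ coset H y.
Proof. by apply: (mulgI (coset H y)); rewrite -cosetM -!conjgC cosetM. Qed.

(** Translates centralising in G / H, as in condition (ii), into conjugation in G modulo H, the form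
    in which transversals are handled. *)
Lemma coset_commute x g :
  commute (coset H x) (coset H g) <-> coset H (g ^ x) = coset H g.
Proof.
rewrite cosetJ -conjg_commute.
by split=> /commute_sym.
Qed.

Lemma coset_conjH h x : inH h -> coset H (x ^ h) = coset H x.
Proof.
move=> Hh; apply/coset_commute.
have -> : coset H h = 1 by rewrite -(mulg1 h) coset_mulH.
exact/commute_sym/commute1.
Qed.

Section InvariantTransversal.
Variable T : set G.
Hypothesis trT : coset_transversal H T.
Hypothesis invT : conj_invariant T.

Lemma transversal_repr g : exists2 t, T t & coset H t = coset H g.
Proof. by have [t [[Tt /rightcosetE tg] _]] := trT g; exists t. Qed.

Lemma transversal_inj t u : T t -> T u -> coset H t = coset H u -> t = u.
Proof.
move=> Tt Tu tu; have [v [_ v_uniq]] := trT u.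
rewrite -(v_uniq t); first exact: v_uniq (conj Tu (proj2 (rightcosetE u u) erefl)).
by split=> //; apply/rightcosetE.
Qed.

Lemma transversal_fix t x :
  T t -> coset H (t ^ x) = coset H t -> commute t x.
Proof.
move=> Tt tx; apply/conjg_commute/transversal_inj => //.
exact: conj_invariantJ.
Qed.

Lemma transversal_centraliser t : T t -> centraliser H t.
Proof. by move=> Tt h Hh; apply: transversal_fix => //; apply: coset_conjH. Qed.

Lemma setprod_centraliserT : [set: G] = setprod H (centraliser H).
Proof.
apply/seteqP; split=> // g _; have [t Tt /esym/coset_eqH gt] := transversal_repr g.
(* Here [t] represents the coset of [g], so [g * t^-1] lies in H. *)
exists (g * t^-1) => //; exists t; last by rewrite mulgVK.
exact: transversal_centraliser.
Qed.

(** By (i), a preimage of [u] can be taken to be some [c] in C_G(H). It commutes with the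
    representative [t] of the coset of [g], and with all of H, hence with [g]. *)
Lemma centraliser1_coset_transversal g :
  centraliser1 (coset H g) `<=` coset H @` setprod H (centraliser1 g).
Proof.
move=> u; rewrite -(coset_repr u) => /coset_commute.
set x := repr u => gx; have [t Tt tg] := transversal_repr g.
have [h Hh [c cH hc]] : setprod H (centraliser H) x.
  by rewrite -setprod_centraliserT.
have xE : coset H x = coset H c by rewrite -hc coset_mulH.
have tc : commute t c.
  by apply: transversal_fix => //; rewrite cosetJ -xE tg -cosetJ.
exists c; last exact/esym.
exists 1; [exact: normalSubgroup1 | exists c; last exact: mul1g].
(* The factor [g * t^-1] lies in H, which [c] centralises. *)
have -> : g = g * t^-1 * t by rewrite mulgVK.
apply: commuteM; last exact: commute_sym.
by apply: cH; apply/coset_eqH.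
Qed.

End InvariantTransversal.

Lemma coset_centraliser1_sub g :
  coset H @` setprod H (centraliser1 g) `<=` centraliser1 (coset H g).
Proof.
move=> _ [_ [h Hh [c cg <-]] <-]; rewrite coset_mulH //.
by rewrite /centraliser1 /= /commute -!cosetM cg.
Qed.

Section ChosenTransversal.
Hypothesis GHC : [set: G] = setprod H (centraliser H).
Hypothesis centH : forall g,
  centraliser1 (coset H g) = coset H @` setprod H (centraliser1 g).

(** The candidates for representing the conjugacy class of [coset H g] in G / H. *)
Definition central_conj g : set G :=
  [set t | centraliser H t /\ exists x, coset H (t ^ x) = coset H g].

(* The common default [1] makes the choice depend on the set
   [central_conj g] only, hence only on the conjugacy class of [coset H g]. *)
Definition class_repr g : G := xget 1 (central_conj g).

Definition class_transversal : set G :=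
  [set y | exists g x, y = class_repr g ^ x].

Lemma class_reprP g : central_conj g (class_repr g).
Proof.
apply: xgetPex; have [h Hh [c cH hc]] : setprod H (centraliser H) g.
  by rewrite -GHC.
by exists c; split=> //; exists 1; rewrite conjg1 -hc coset_mulH.
Qed.

Lemma central_conjJ g g' x :
  coset H (g ^ x) = coset H g' -> central_conj g `<=` central_conj g'.
Proof.
move=> gx t [tH [y ty]]; split=> //; exists (y * x).
by rewrite conjgM cosetJ ty -cosetJ.
Qed.

Lemma class_repr_eq g g' x :
  coset H (class_repr g ^ x) = coset H g' -> class_repr g = class_repr g'.
Proof.
move=> gx; rewrite /class_repr; congr xget; have [_ [y gy]] := class_reprP g.
apply/seteqP; split.
  (* Modulo H, [y^-1] takes [g] back to [class_repr g], and [x] takes that to [g']. *)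
  apply: (@central_conjJ _ _ (y^-1 * x)).
  by rewrite conjgM cosetJ [in LHS]cosetJ -gy -cosetJ conjgK -cosetJ.
apply: (@central_conjJ _ _ (x^-1 * y)).
by rewrite conjgM cosetJ [in LHS]cosetJ -gx -cosetJ conjgK -cosetJ.
Qed.

(** The image of [x * y^-1] centralises [coset H t], so (ii) puts [x * y^-1] in H C_G(t); both
    factors fix [t] under conjugation. *)
Lemma central_conj_inj t x y : centraliser H t ->
  coset H (t ^ x) = coset H (t ^ y) -> t ^ x = t ^ y.
Proof.
move=> tH txy.
have : centraliser1 (coset H t) (coset H (x * y^-1)).
  by apply/coset_commute; rewrite conjgM cosetJ txy -cosetJ conjgK.
rewrite centH => -[_ [h Hh [c ct <-]]] /coset_eqH Hz.
have fixc z : centraliser1 t z -> t ^ z = t.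
  by move=> zt; apply/conjg_commute/commute_sym.
have fixH k : inH k -> t ^ k = t by move=> Hk; apply/conjg_commute/tH.
(* The inverted factor lies in H by [Hz], so everything before [y] fixes [t]. *)
have -> : x = (h * c / (x / y))^-1 * (h * c) * y.
  by rewrite [in RHS]invgM invgK !mulgVK.
rewrite !conjgM (fixH (_^-1)); last exact: normalSubgroupV.
by rewrite fixH // fixc.
Qed.

Lemma class_transversalP : coset_transversal H class_transversal.
Proof.
move=> g; have [tH [x tx]] := class_reprP g.
exists (class_repr g ^ x); split.
  by split; [exists g, x | apply/rightcosetE].
move=> _ [[g' [y ->]] /rightcosetE ty].
(* Both elements become conjugates of the single representative [class_repr g]. *)
move: (ty); rewrite (class_repr_eq _ _ _ ty) => {}ty.
by apply: central_conj_inj => //; rewrite tx ty.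
Qed.

Lemma class_transversal_invariant : conj_invariant class_transversal.
Proof.
move=> z; apply/seteqP; split=> [_ [_ [g [x ->]] <-]|_ [g [x ->]]].
  by exists g, (x * z); rewrite conjgM.
exists (class_repr g ^ (x * z^-1)); first by exists g, (x * z^-1).
by rewrite -conjgM mulgVK.
Qed.

End ChosenTransversal.

End Cosets.

Theorem proposition2p3 (G : groupType) (H : normalSubgroup G) :
  (exists T : set G, coset_transversal H T /\ conj_invariant T) <->
  ([set: G] = setprod H (centraliser H) /\
   forall g : G,
     centraliser1 (coset H g) = coset H @` setprod H (centraliser1 g)).
Proof.
split=> [[T [trT invT]]|[GHC centH]].
  split=> [|g]; first exact: setprod_centraliserT trT invT.
  apply/seteqP; split; last exact: coset_centraliser1_sub.
  exact: centraliser1_coset_transversal trT invT g.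
exists (class_transversal G H); split; first exact: class_transversalP.
exact: class_transversal_invariant.
Qed.
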